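(* Let $\tilde\alpha$ be the highest root of the Lie algebra $\mathfrak{sl}_{r+1}(\mathbb{C})$ of type $A_r$, with $r\ge 1$. The set $\mathrm{BAS}(\tilde\alpha,-\tilde\alpha)$ of basic allowable subwords of $\mathcal{A}(\tilde\alpha,-\tilde\alpha)$ consists of (a) $s_k$ with $1 \le k \le r$, (b) $s_{k+1}s_{k}$ with $2 \le k \le r-2$, (c) $s_{k}s_{k+1}$ with $2 \le k \le r-2$, (d) $s_{k}s_{k+1}s_{k}$ with $2 \le k \le r-2$, and (e) $s_{k+2}s_{k}s_{k+1}$ with $2 \le k \le r-3$.
   Context: Type $A_r$: the simple roots are $\alpha_i=e_i-e_{i+1}\in\mathbb{R}^{r+1}$ for $1\le i\le r$; the positive roots are $\alpha_i+\alpha_{i+1}+\cdots+\alpha_j$ for $1\le i\le j\le r$; the highest root is $\tilde\alpha=\alpha_1+\cdots+\alpha_r$; $\rho$ is half the sum of the positive roots. The Weyl group $W\cong\mathfrak{S}_{r+1}$ is generated by the simple reflections $s_1,\dots,s_r$, where $s_k$ swaps $e_k$ and $e_{k+1}$. $\wp(\xi)$ is the number of ways of expressing $\xi$ as a linear combination of positive roots with nonnegative integer coefficients, and $\mathcal{A}(\lambda,\mu)=\{\sigma\in W:\wp(\sigma(\lambda+\rho)-\mu-\rho)>0\}$. The influence of $\sigma\in W$ is $I(\sigma)=\{i: s_i\text{ is in a reduced word for }\sigma\}$ and the extended influence $\overline I(\sigma)$ is the set of $i\in\{1,\dots,r\}$ such that $i\in I(\sigma)$ or $i$ is adjacent to some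 $j\in I(\sigma)$ in the Dynkin diagram (the path $1-2-\cdots-r$). $I(\sigma)$ is connected if it induces a connected subgraph of the Dynkin diagram. $\sigma,\tau$ are independent if $I(\sigma)\cap\overline I(\tau)=\emptyset$; a set is pairwise independent if any two distinct elements of it are independent. For $\lambda$ dominant integral and $\mathcal{A}(\lambda,\mu)\neq\emptyset$, $\mathrm{BAS}(\lambda,\mu)$ (the basic allowable subwords) is the unique subset $S\subseteq\mathcal{A}(\lambda,\mu)$ with $1\notin S$ such that each $b\in S$ has connected influence and every $\sigma\in\mathcal{A}(\lambda,\mu)$ is a product of the elements of a (possibly empty) pairwise independent subset of $S$.
   Formalization: The formal theorem assumes r ≥ 2 instead of r ≥ 1: for r = 1, s_1(α̃+ρ)+α̃−ρ = −α_1, so s_1 is not in A(α̃,−α̃) and BAS(α̃,−α̃) is empty, although (a) lists s_1. *)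

(* Defs.v *)
From mathcomp Require Import all_boot all_order all_algebra all_fingroup.
From mathcomp Require Import finmap all_classical reals.

Set Implicit Arguments.
Unset Strict Implicit.
Unset Printing Implicit Defensive.

Import Order.TTheory GRing.Theory Num.Theory.
Local Open Scope ring_scope.

(* Coordinates, simple roots and simple reflections are indexed from 1 by
   natural numbers: e_k for 1 <= k <= r+1, alpha_k and s_k for 1 <= k <= r.
   Outside these ranges [inord] returns junk values, so every quantifier over
   such an index carries its range. *)

Definition std_basis (R : realType) (r k : nat) : 'rV[R]_r.+1 :=
  delta_mx 0 (inord k.-1).

Definition simple_root (R : realType) (r k : nat) : 'rV[R]_r.+1 :=
  std_basis R r k - std_basis R r k.+1.

(* The pair (i, j) with 1 <= i <= j <= r stands for alpha_i + ... + alpha_j. *)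
Definition pos_index (r : nat) : finType :=
  {p : 'I_r.+1 * 'I_r.+1 | (0 < p.1 <= p.2)%N}.

Definition pos_root (R : realType) (r : nat) (a : pos_index r) : 'rV[R]_r.+1 :=
  \sum_((val a).1 <= k < (val a).2.+1) simple_root R r k.

Definition highest_root (R : realType) (r : nat) : 'rV[R]_r.+1 :=
  \sum_(1 <= k < r.+1) simple_root R r k.

Definition rho (R : realType) (r : nat) : 'rV[R]_r.+1 :=
  2^-1 *: \sum_(a : pos_index r) pos_root R a.

Definition kostant_partitions (R : realType) (r : nat) (xi : 'rV[R]_r.+1) :
    set {ffun pos_index r -> nat} :=
  [set m | \sum_(a : pos_index r) pos_root R a *+ m a = xi]%classic.

(* [fset_set] is set0 on infinite sets; see [finite_kostant_partitions] below. *)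
Definition kostant (R : realType) (r : nat) (xi : 'rV[R]_r.+1) : nat :=
  #|` fset_set (kostant_partitions xi)|.

Definition simple_refl (r k : nat) : 'S_r.+1 := tperm (inord k.-1) (inord k).

Definition weyl_group (r : nat) : {set 'S_r.+1} :=
  <<[set simple_refl r k.+1 | k : 'I_r]>>%g.

(* W acts on the left, sigma e_i = e_(sigma i). *)
Definition weyl_act (R : realType) (r : nat) (sigma : 'S_r.+1)
    (v : 'rV[R]_r.+1) : 'rV[R]_r.+1 :=
  col_perm sigma^-1%g v.

Definition alternation_set (R : realType) (r : nat) (lam mu : 'rV[R]_r.+1) :
    {set 'S_r.+1} :=
  [set sigma in weyl_group r |
    (0 < kostant (weyl_act sigma (lam + rho R r) - mu - rho R r)%R)%N].

(* In the product of 'S_n, (s * t) x = t (s x), whereas the action above and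
   words in the s_k use the composition of functions. *)
Definition weyl_mul (r : nat) (sigma tau : 'S_r.+1) : 'S_r.+1 :=
  (tau * sigma)%g.

(* [word_elt r [:: i1; ...; im]] is s_i1 s_i2 ... s_im; s_im acts first. *)
Definition word_elt (r : nat) (w : seq nat) : 'S_r.+1 :=
  foldr (fun k sigma => weyl_mul (simple_refl r k) sigma) 1%g w.

Definition is_word (r : nat) (w : seq nat) : bool :=
  all (fun k => 1 <= k <= r)%N w.

Definition reduced_word (r : nat) (sigma : 'S_r.+1) (w : seq nat) : Prop :=
  [/\ is_word r w, word_elt r w = sigma
    & forall w', is_word r w' -> word_elt r w' = sigma -> (size w <= size w')%N].

Definition influence (r : nat) (sigma : 'S_r.+1) : set nat :=
  [set i | exists2 w, reduced_word sigma w & i \in w]%classic.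

Definition dynkin_adj : rel nat := fun i j => (j == i.+1) || (i == j.+1).

Definition ext_influence (r : nat) (sigma : 'S_r.+1) : set nat :=
  [set i | (1 <= i <= r)%N /\
     (influence sigma i \/ exists2 j, influence sigma j & dynkin_adj i j)]%classic.

Definition dynkin_connected (D : set nat) : Prop :=
  forall i j, D i -> D j ->
    exists p, [/\ path dynkin_adj i p, last i p = j & forall k, k \in p -> D k].

Definition independent (r : nat) (sigma tau : 'S_r.+1) : Prop :=
  (influence sigma `&` ext_influence tau = set0)%classic.

Definition pairwise_independent (r : nat) (T : {set 'S_r.+1}) : Prop :=
  forall sigma tau, sigma \in T -> tau \in T -> sigma <> tau ->
    independent sigma tau.

(* Independent elements commute, so the order of the factors is immaterial. *)
Definition is_BAS (R : realType) (r : nat) (lam mu : 'rV[R]_r.+1)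
    (S : {set 'S_r.+1}) : Prop :=
  [/\ S \subset alternation_set lam mu, 1%g \notin S,
      forall b, b \in S -> dynkin_connected (influence b)
    & forall sigma, sigma \in alternation_set lam mu ->
        exists T : {set 'S_r.+1},
          [/\ T \subset S, pairwise_independent T
            & sigma = (\prod_(b in T) b)%g]].

Lemma finite_kostant_partitions (R : realType) (r : nat) (xi : 'rV[R]_r.+1) :
  finite_set (kostant_partitions xi).
Proof.
pose ht (v : 'rV[R]_r.+1) : R := \sum_j v 0 j *+ (r - j).
have htD u v : ht (u + v) = ht u + ht v.
  by rewrite /ht -big_split; apply: eq_bigr => j _; rewrite mxE mulrnDl.
have ht0 : ht 0 = 0 by apply: big1 => j _; rewrite mxE mul0rn.
have htN v : ht (- v) = - ht v.
  by apply/eqP; rewrite -addr_eq0 -htD addNr ht0.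
have htM v n : ht (v *+ n) = ht v *+ n.
  by elim: n => [|n IH]; rewrite ?mulr0n // !mulrS htD IH.
have htsum I (s : seq I) F : ht (\sum_(i <- s) F i) = \sum_(i <- s) ht (F i).
  by elim: s => [|i s IH]; rewrite ?big_nil // !big_cons htD IH.
have hte (k : 'I_r.+1) : ht (delta_mx 0 k) = (r - k)%:R.
  rewrite /ht (bigD1 k) //= mxE !eqxx big1 ?addr0 // => j /negPf jk.
  by rewrite mxE jk andbF mul0rn.
have hts k : (0 < k <= r)%N -> ht (simple_root R r k) = 1.
  case: k => // k kr; rewrite htD htN !hte /= !inordK //; last exact: leqW.
  by rewrite -(subnSK kr) mulrS addrK.
have htp (a : pos_index r) : ht (pos_root R a) = ((val a).2.+1 - (val a).1)%:R.
  rewrite htsum (eq_big_nat _ _ (F2 := fun=> 1)).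
    by rewrite sumr_const_nat.
  case: a => -[i j] /= /andP[i0 ij] k /andP[ik kj]; apply: hts.
  by rewrite (leq_trans i0 ik) (leq_trans (kj : (k <= j)%N)) // -ltnS.
have bnd m : kostant_partitions xi m ->
    ht xi = (\sum_(a : pos_index r) ((val a).2.+1 - (val a).1) * m a)%N%:R.
  move=> <-; rewrite htsum natr_sum; apply: eq_bigr => a _.
  by rewrite htM htp natrM mulr_natr.
have [->//|/set0P[m0 /bnd]] := eqVneq (kostant_partitions xi) set0%classic.
set N := (\sum_ _ _)%N => hN.
pose g (f : {ffun pos_index r -> 'I_N.+1}) : {ffun pos_index r -> nat} :=
  [ffun a => nat_of_ord (f a)].
apply: (@sub_finite_set _ _ (g @` [set: _])%classic); last first.
  exact/finite_image/finite_finset.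
move=> m mP; have mN a : (m a <= N)%N.
  have /eqP := bnd m mP; rewrite hN eqr_nat => /eqP ->.
  rewrite (bigD1 a) //=; apply/(leq_trans _ (leq_addr _ _))/leq_pmull.
  by case: a => -[i j] /= /andP[_ ij]; rewrite subn_gt0 ltnS.
exists [ffun a => inord (m a)] => //; apply/ffunP => a.
by rewrite !ffunE inordK // ltnS.
Qed.

(* Main.v *)
Require Import Defs.
From mathcomp Require Import all_boot all_order all_algebra all_fingroup.
From mathcomp Require Import finmap all_classical reals zify ring lra.

(** Write sigma as a permutation of {0, ..., r}, and say that sigma crosses m
    (1 <= m <= r) when some x < m has sigma x >= m.  Everything is controlled by
    the set of crossed m.

    - This set is the influence of sigma ([influenceE]): a word without s_m
      preserves {0, ..., m-1}, and along a reduced word, where each left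
      multiplication creates an inversion, a crossing is never undone.

    - The coefficient of alpha_m in a weight is the sum of its first m
      coordinates, and the partition function is positive exactly when these
      coefficients are natural numbers.  For
      sigma(highest root + rho) + highest root - rho they equal
      1 + [sigma 0 < m] - [sigma r < m] - excess_m, where excess_m is the sum of
      tau j - j over j < m, tau being the inverse of sigma
      ([alternation_setP]).  So membership is a local condition at each m, and
      it forces excess_m <= 2.

    - Cutting {0, ..., r} at the uncrossed m writes any sigma as the product of
      its restrictions to the resulting blocks, which are pairwise independent
      and have connected influence; each of them inherits the local conditions
      of sigma ([allowable_block]).  Conversely, a connected element that is a
      product of pairwise independent factors is one of the factors
      ([connected_prod]).  Hence the basic allowable subwords are exactly the
      nontrivial allowable elements with connected influence ([is_BAS_iff]).

    - For such an element let k be its first crossed index.  The excess is 0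
      before k, positive and at most 2 on the crossed interval, and 0 afterwards.
      Following the values tau (k-1), tau k, ... leaves the excess profiles (1),
      (1, 2), (2, 1), (2, 2) and (2, 1, 2), each coming from a single permutation
      ([excess_shapes]); these are s_k, s_{k+1} s_k, s_k s_{k+1},
      s_k s_{k+1} s_k and s_{k+2} s_k s_{k+1} respectively.  An excess of 2 at m
      also requires sigma 0 < m <= sigma r, and this gives the ranges of k. *)

Set Implicit Arguments.
Unset Strict Implicit.
Unset Printing Implicit Defensive.

Import GRing.Theory Num.Theory.

(** * Permutations of {0, ..., r} as functions on the natural numbers *)

(** The action of a permutation of 'I_r.+1 on all natural numbers, fixing those
    above r, so that values can be compared and added by linear arithmetic. *)
Definition nat_perm (r : nat) (s : 'S_r.+1) (j : nat) : nat :=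
  if (j < r.+1)%N then val (s (inord j)) else j.

Lemma nat_permE (r : nat) (s : 'S_r.+1) (x : 'I_r.+1) :
  nat_perm s x = s x :> nat.
Proof. by rewrite /nat_perm ltn_ord inord_val. Qed.

Lemma nat_perm_le (r : nat) (s : 'S_r.+1) (j : nat) :
  (j <= r)%N -> (nat_perm s j <= r)%N.
Proof. by rewrite /nat_perm ltnS => ->; rewrite -ltnS ltn_ord. Qed.

Lemma nat_perm_out (r : nat) (s : 'S_r.+1) (j : nat) :
  (r < j)%N -> nat_perm s j = j.
Proof. by move=> rj; rewrite /nat_perm ltnS leqNgt rj. Qed.

Lemma nat_permM (r : nat) (s t : 'S_r.+1) (j : nat) :
  nat_perm (s * t)%g j = nat_perm t (nat_perm s j).
Proof.
have [jr|rj] := leqP j r; last by rewrite !nat_perm_out.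
by rewrite -[j](@inordK r) ?ltnS // !nat_permE permM.
Qed.

Lemma nat_perm1 (r j : nat) : nat_perm (1%g : 'S_r.+1) j = j.
Proof. by rewrite /nat_perm perm1; case: ifP => // jr; rewrite /= inordK. Qed.

Lemma nat_permK (r : nat) (s : 'S_r.+1) : cancel (nat_perm s) (nat_perm s^-1%g).
Proof. by move=> j; rewrite -nat_permM mulgV nat_perm1. Qed.

Lemma nat_permKV (r : nat) (s : 'S_r.+1) : cancel (nat_perm s^-1%g) (nat_perm s).
Proof. by move=> j; rewrite -nat_permM mulVg nat_perm1. Qed.

Lemma eq_nat_perm (r : nat) (s t : 'S_r.+1) : nat_perm s =1 nat_perm t -> s = t.
Proof. by move=> st; apply/permP => x; apply/val_inj; rewrite /= -!nat_permE. Qed.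

Definition nat_swap (k j : nat) : nat :=
  if j == k.-1 then k else if j == k then k.-1 else j.

Lemma nat_perm_refl (r k j : nat) : (1 <= k <= r)%N ->
  nat_perm (simple_refl r k) j = nat_swap k j.
Proof.
move=> kr; rewrite /nat_perm /nat_swap; case: ifP => jr; last by do 2?case: eqP; lia.
have eqj i : (i <= r)%N -> (@inord r j == inord i) = (j == i).
  by move=> ir; rewrite -val_eqE /= !inordK.
rewrite /simple_refl permE /= !eqj; try lia.
by case: ifP => _; [|case: ifP => _]; rewrite inordK //; lia.
Qed.

Lemma nat_swap_lt (k x y : nat) : (0 < k)%N -> x <> y ->
    ~ (x = k.-1 /\ y = k) -> ~ (x = k /\ y = k.-1) ->
  (nat_swap k y < nat_swap k x)%N = (y < x)%N.
Proof. by rewrite /nat_swap; do ?case: eqP; lia. Qed.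

(** * Crossed indices and influence *)

Definition crosses (r : nat) (s : 'S_r.+1) (m : nat) : bool :=
  [exists x : 'I_r.+1, (x < m <= s x)%N].

Lemma crossesP (r : nat) (s : 'S_r.+1) (m : nat) :
  reflect (exists j, (j < m <= nat_perm s j)%N) (crosses s m).
Proof.
apply: (iffP existsP) => [[x xm]|[j jm]]; first by exists (val x); rewrite nat_permE.
exists (inord j); have [jr|rj] := leqP j r; last by move: jm; rewrite nat_perm_out //; lia.
by rewrite -nat_permE inordK.
Qed.

Lemma crosses_range (r : nat) (s : 'S_r.+1) (m : nat) :
  crosses s m -> (1 <= m <= r)%N.
Proof. by case/existsP => x; have := ltn_ord (s x); lia. Qed.

(** A permutation mapping the finite set {0, ..., m-1} into itself maps it onto
    itself, hence also preserves the complement. *)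
Lemma uncrossed_lt (r : nat) (s : 'S_r.+1) (m : nat) (x : 'I_r.+1) :
  ~~ crosses s m -> (s x < m)%N = (x < m)%N.
Proof.
move=> /existsPn ncr; have lt_m (y : 'I_r.+1) : (y < m)%N -> (s y < m)%N.
  by move=> ym; have := ncr y; rewrite ym -ltnNge.
apply/idP/idP; last exact: lt_m.
pose A := [set y : 'I_r.+1 | (y < m)%N].
have /eqP imA : s @: A == A.
  rewrite eqEcard card_imset ?leqnn ?andbT; last exact: perm_inj.
  by apply/fintype.subsetP => _ /imsetP[y + ->]; rewrite !inE; apply: lt_m.
move=> sxm; have : s x \in s @: A by rewrite imA inE.
by rewrite mem_imset ?inE //; exact: perm_inj.
Qed.

Lemma crossesV (r : nat) (s : 'S_r.+1) (m : nat) : crosses s^-1%g m = crosses s m.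
Proof.
suff half t : ~~ @crosses r t m -> ~~ crosses t^-1%g m.
  by apply/idP/idP; apply: contraLR => /half; rewrite ?invgK.
move=> ncr; apply/existsPn => x; have := uncrossed_lt (t^-1%g x) ncr.
by rewrite permKV; case: (ltnP x m) => //= _; rewrite -ltnNge => <-.
Qed.

(** If neither x nor x+1 is crossed, then s preserves both {0, ..., x-1} and
    {0, ..., x}, hence fixes x. *)
Lemma crosses_moved (r : nat) (s : 'S_r.+1) (x : 'I_r.+1) :
  s x != x -> crosses s x \/ crosses s x.+1.
Proof.
move=> sx; have [|nc] := boolP (crosses s x); first by left.
have [|nc1] := boolP (crosses s x.+1); first by right.
have := uncrossed_lt x nc; have := uncrossed_lt x nc1.
by rewrite -val_eqE /= in sx; lia.
Qed.

Lemma crosses_neq1 (r : nat) (s : 'S_r.+1) : s != 1%g -> exists m, crosses s m.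
Proof.
move=> s1; have [x sx] : exists x, s x != x.
  apply/existsP; apply: contraNT s1 => /existsPn fix_s.
  by apply/eqP/permP => x; rewrite perm1; apply/eqP; rewrite -[_ == _]negbK fix_s.
by case: (crosses_moved sx); [exists x|exists x.+1].
Qed.

Definition inversions (r : nat) (s : 'S_r.+1) : {set 'I_r.+1 * 'I_r.+1} :=
  [set p : 'I_r.+1 * 'I_r.+1 | (p.1 < p.2)%N && (s p.2 < s p.1)%N].

(** In one-line notation k-1 stands to the left of k; equivalently, multiplying
    by s_k on the left increases the length. *)
Definition ascent (r : nat) (s : 'S_r.+1) (k : nat) : bool :=
  (nat_perm s^-1%g k.-1 < nat_perm s^-1%g k)%N.

Lemma nat_perm_simple_mul (r k : nat) (s : 'S_r.+1) (j : nat) : (1 <= k <= r)%N ->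
  nat_perm (weyl_mul (simple_refl r k) s) j = nat_swap k (nat_perm s j).
Proof. by move=> kr; rewrite nat_permM nat_perm_refl. Qed.

Lemma simple_mulK (r k : nat) (s : 'S_r.+1) :
  weyl_mul (simple_refl r k) (weyl_mul (simple_refl r k) s) = s.
Proof. by rewrite /weyl_mul -mulgA tperm2 mulg1. Qed.

(** Swapping the adjacent values k-1 and k alters no other comparison between
    values, so the only new inversion is formed by their two positions. *)
Lemma inversions_ascent (r k : nat) (s : 'S_r.+1) : (1 <= k <= r)%N -> ascent s k ->
  #|inversions (weyl_mul (simple_refl r k) s)| = #|inversions s|.+1.
Proof.
move=> kr asc; pose u : 'I_r.+1 := s^-1%g (inord k.-1); pose v : 'I_r.+1 := s^-1%g (inord k).
have su : s u = k.-1 :> nat by rewrite permKV inordK //; lia.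
have sv : s v = k :> nat by rewrite permKV inordK //; lia.
have uE : nat_perm s^-1%g k.-1 = u by rewrite -su -nat_permE nat_permK.
have vE : nat_perm s^-1%g k = v by rewrite -sv -nat_permE nat_permK.
have uv : (u < v)%N by rewrite -uE -vE.
have eq_u (x : 'I_r.+1) : nat_perm s x = k.-1 -> x = u :> nat.
  by move=> sx; rewrite -uE -sx nat_permK.
have eq_v (x : 'I_r.+1) : nat_perm s x = k -> x = v :> nat.
  by move=> sx; rewrite -vE -sx nat_permK.
suff -> : inversions (weyl_mul (simple_refl r k) s) = (u, v) |: inversions s.
  rewrite cardsU1 !inE /= su sv; lia.
apply/setP => -[a b]; rewrite !inE /= xpair_eqE -!nat_permE !nat_perm_simple_mul //.
have [/andP[/eqP-> /eqP->]|nuv] /= := boolP ((a == u) && (b == v)).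
  by rewrite uv !nat_permE su sv /nat_swap !eqxx; do ?case: eqP; lia.
have [ab|] //= := boolP (a < b)%N; apply: nat_swap_lt => //.
- lia.
- by move=> sab; move: ab; rewrite -(nat_permK s a) sab nat_permK ltnn.
- case=> /eq_u au /eq_v bv; case/negP: nuv; apply/andP.
  by split; apply/eqP/val_inj.
- by case=> /eq_v av /eq_u bu; lia.
Qed.

Lemma ascent_simple_mul (r k : nat) (s : 'S_r.+1) : (1 <= k <= r)%N ->
  ascent (weyl_mul (simple_refl r k) s) k = ~~ ascent s k.
Proof.
move=> kr; rewrite /ascent /weyl_mul invMg /simple_refl tpermV.
rewrite !nat_permM !nat_perm_refl // /nat_swap !eqxx.
have -> : (k == k.-1) = false by lia.
have : nat_perm s^-1%g k.-1 <> nat_perm s^-1%g k.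
  by move/(can_inj (nat_permK s^-1%g)); lia.
by rewrite ltn_neqAle eq_sym -leqNgt => /eqP ->.
Qed.

Lemma inversions_descent (r k : nat) (s : 'S_r.+1) : (1 <= k <= r)%N -> ~~ ascent s k ->
  #|inversions s| = #|inversions (weyl_mul (simple_refl r k) s)|.+1.
Proof.
move=> kr desc; rewrite -{1}(simple_mulK k s) inversions_ascent //.
by rewrite ascent_simple_mul.
Qed.

Lemma inversions1 (r : nat) : #|inversions (1%g : 'S_r.+1)| = 0.
Proof.
apply/eqP; rewrite cards_eq0; apply/eqP/setP => -[a b].
by rewrite !inE !perm1 /=; lia.
Qed.

Lemma inversions_word (r : nat) (w : seq nat) : is_word r w ->
  (#|inversions (word_elt r w)| <= size w)%N.
Proof.
elim: w => [|k w IH] /=; first by rewrite inversions1.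
case/andP=> kr /IH; have [asc|desc] := boolP (ascent (word_elt r w) k).
  by rewrite inversions_ascent.
by rewrite (inversions_descent kr desc) => /ltnW/leqW.
Qed.

Lemma increasing_id (r : nat) (f : nat -> nat) :
    (forall k, (1 <= k <= r)%N -> (f k.-1 < f k)%N) -> (f r <= r)%N ->
  forall j, (j <= r)%N -> f j = j.
Proof.
move=> f_incr f_r.
have ge j : (j <= r)%N -> (j <= f j)%N.
  by elim: j => // j IH jr; have := f_incr j.+1; rewrite /=; have := IH; lia.
have le d : (d <= r)%N -> (f (r - d) <= r - d)%N.
  elim: d => [|d IH] dr; first by rewrite subn0.
  have := f_incr (r - d); have -> : (r - d).-1 = (r - d.+1) by lia.
  by have := IH; lia.
move=> j jr; have := ge j jr; have := le (r - j); have -> : r - (r - j) = j by lia.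
by lia.
Qed.

(** Sorting by adjacent transpositions: as long as s is not the identity some
    left multiplication by a simple reflection removes an inversion. *)
Lemma shortest_word (r : nat) (s : 'S_r.+1) :
  exists w, [/\ is_word r w, word_elt r w = s & size w = #|inversions s|].
Proof.
have [n] := ubnP #|inversions s|; elim: n s => // n IH s.
have [/existsP[k desc] sn|/existsPn no_desc _] := boolP [exists k : 'I_r, ~~ ascent s k.+1].
  have kr : (1 <= k.+1 <= r)%N by have := ltn_ord k; lia.
  have inv_s := inversions_descent kr desc.
  have [|w [wr ws sz]] := IH (weyl_mul (simple_refl r k.+1) s); first by lia.
  exists (k.+1 :: w); split; first by apply/andP; split.
    by rewrite /= ws simple_mulK.
  by rewrite /= sz inv_s.
have sV : forall j, (j <= r)%N -> nat_perm s^-1%g j = j.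
  apply: increasing_id => [k kr|]; last exact: nat_perm_le.
  have k'r : (k.-1 < r)%N by lia.
  by have := no_desc (Ordinal k'r); rewrite negbK /ascent /= prednK //; lia.
have -> : s = 1%g.
  apply: eq_nat_perm => j; rewrite nat_perm1.
  have [jr|rj] := leqP j r; last by rewrite nat_perm_out.
  by rewrite -{1}(sV j jr) nat_permKV.
by exists [::]; rewrite inversions1.
Qed.

Lemma reduced_wordP (r : nat) (s : 'S_r.+1) (w : seq nat) :
  reduced_word s w <-> [/\ is_word r w, word_elt r w = s & size w = #|inversions s|].
Proof.
split=> [[wr ws w_min]|[wr ws sz]].
  split=> //; apply/eqP; rewrite eqn_leq -{2}ws inversions_word // andbT.
  by have [w' [w'r w's <-]] := shortest_word s; apply: w_min.
by split=> // w' w'r w's; rewrite sz -w's; exact: inversions_word.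
Qed.

(** Swapping the values k-1 and k can only affect the crossing of k.  When k-1
    stands to the left of k, a position below k that loses the value k is replaced
    by that of k-1, which is further left; and if k was not crossed, then the
    position of k-1 is below k and now crosses it. *)
Lemma crosses_ascent (r k m : nat) (s : 'S_r.+1) : (1 <= k <= r)%N -> ascent s k ->
  crosses s m || (m == k) -> crosses (weyl_mul (simple_refl r k) s) m.
Proof.
move=> kr asc s_m; pose u := nat_perm s^-1%g k.-1.
have su : nat_perm s u = k.-1 by rewrite nat_permKV.
have below j : (j < k <= nat_perm s j)%N -> crosses (weyl_mul (simple_refl r k) s) k.
  move=> jk; apply/crossesP; have [sj|sj] := eqVneq (nat_perm s j) k.
    exists u; rewrite nat_perm_simple_mul // su /nat_swap eqxx leqnn andbT.
    by move: asc; rewrite /ascent -/u -sj nat_permK; lia.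
  exists j; rewrite nat_perm_simple_mul // /nat_swap.
  by do ?case: eqP; lia.
have [mk|mk] := eqVneq m k.
  rewrite mk; have [/crossesP[j]|nc] := boolP (crosses s k); first exact: below.
  apply/crossesP; exists u; rewrite nat_perm_simple_mul // su /nat_swap eqxx leqnn andbT.
  have := @uncrossed_lt r s^-1%g k (inord k.-1); rewrite crossesV => /(_ nc).
  rewrite -nat_permE inordK; last by lia.
  by rewrite -/u; lia.
move: s_m; rewrite (negPf mk) orbF => /crossesP[j jm].
apply/crossesP; exists j; rewrite nat_perm_simple_mul // /nat_swap.
by move/eqP: mk; do ?case: eqP; lia.
Qed.

Lemma crosses_word (r : nat) (w : seq nat) (m : nat) :
  is_word r w -> crosses (word_elt r w) m -> m \in w.
Proof.
move=> wr; apply: contraTT; elim: w wr => [_ _|k w IH] /=.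
  by apply/existsPn => x; rewrite perm1; lia.
case/andP=> kr /IH{}IH; rewrite inE negb_or => /andP[mk /IH nc].
apply/negP => /crossesP[j]; rewrite nat_perm_simple_mul // => jm; case/negP: nc.
apply/crossesP; exists j; move: jm; rewrite /nat_swap.
by move/eqP: mk; do ?case: eqP; lia.
Qed.

Lemma shortest_word_crosses (r : nat) (w : seq nat) (m : nat) : is_word r w ->
  size w = #|inversions (word_elt r w)| -> m \in w -> crosses (word_elt r w) m.
Proof.
elim: w => //= k w IH /andP[kr wr] sz; have le_w := inversions_word wr.
have [asc|desc] := boolP (ascent (word_elt r w) k); last first.
  by move: le_w; rewrite (inversions_descent kr desc) -sz; lia.
rewrite inversions_ascent // in sz; rewrite inE => m_kw.
apply: crosses_ascent => //; case/orP: m_kw => [->|]; first by rewrite orbT.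
by move=> /IH->; first by []; by case: sz.
Qed.

(** This identifies the influence, defined through reduced words, with a property
    that is local in the one-line notation. *)
Lemma influenceE (r : nat) (s : 'S_r.+1) (m : nat) : influence s m <-> crosses s m.
Proof.
split=> [[w /reduced_wordP[wr <- sz] mw]|s_m]; first exact: shortest_word_crosses.
have [w w_red] := shortest_word s; exists w; first exact/reduced_wordP.
case: w_red => wr ws _; apply: (@crosses_word r) => //; by rewrite ws.
Qed.

Lemma weyl_groupT (r : nat) : weyl_group r = [set: 'S_r.+1].
Proof.
apply/setP => s; rewrite inE; have [w [wr <- _]] := shortest_word s.
elim: w wr => [_|k w IH /= /andP[kr /IH w_in]]; first exact: group1.
apply: groupM => //; apply/mem_gen/imsetP.
have k'r : (k.-1 < r)%N by lia.
by exists (Ordinal k'r); rewrite //= prednK //; lia.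
Qed.

(** * The alternation set in coordinates *)

(** The functional dual to the simple roots: on the root lattice, [partial_sum m]
    is the coefficient of alpha_m. *)
Definition partial_sum (R : realType) (r m : nat) (v : 'rV[R]_r.+1) : R :=
  (\sum_(j < r.+1 | (j < m)%N) v 0 j)%R.

Lemma partial_sumD (R : realType) (r m : nat) (v w : 'rV[R]_r.+1) :
  (partial_sum m (v + w) = partial_sum m v + partial_sum m w)%R.
Proof. by rewrite /partial_sum -big_split; apply: eq_bigr => j _; rewrite mxE. Qed.

Lemma partial_sum0 (R : realType) (r m : nat) : partial_sum m (0 : 'rV[R]_r.+1)%R = 0%R.
Proof. by apply: big1 => j _; rewrite mxE. Qed.

Lemma partial_sumN (R : realType) (r m : nat) (v : 'rV[R]_r.+1) :
  (partial_sum m (- v) = - partial_sum m v)%R.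
Proof. by rewrite /partial_sum -sumrN; apply: eq_bigr => j _; rewrite mxE. Qed.

Lemma partial_sumMn (R : realType) (r m n : nat) (v : 'rV[R]_r.+1) :
  (partial_sum m (v *+ n) = partial_sum m v *+ n)%R.
Proof.
elim: n => [|n IH]; first by rewrite !mulr0n partial_sum0.
by rewrite !mulrS partial_sumD IH.
Qed.

Lemma partial_sum_sum (R : realType) (r m : nat) (I : Type) (s : seq I)
    (P : pred I) (F : I -> 'rV[R]_r.+1) :
  (partial_sum m (\sum_(i <- s | P i) F i) = \sum_(i <- s | P i) partial_sum m (F i))%R.
Proof. by apply: (big_morph _ (partial_sumD m)); exact: partial_sum0. Qed.

Lemma coord_partial_sum (R : realType) (r : nat) (v : 'rV[R]_r.+1) (j : 'I_r.+1) :
  (v 0 j = partial_sum j.+1 v - partial_sum j v)%R.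
Proof.
rewrite [partial_sum j.+1 v](bigD1 j) //= [(v 0 j + _)%R]addrC addrAC.
rewrite -[LHS]add0r; congr (_ + _)%R; apply/esym/eqP; rewrite subr_eq0; apply/eqP.
by apply: eq_bigl => i /=; rewrite ltnS andbC -val_eqE -ltn_neqAle.
Qed.

Lemma partial_sum_0 (R : realType) (r : nat) (v : 'rV[R]_r.+1) : partial_sum 0 v = 0%R.
Proof. exact: big_pred0_eq. Qed.

Lemma partial_sum_inj (R : realType) (r : nat) (v w : 'rV[R]_r.+1) :
  (forall m, (1 <= m <= r.+1)%N -> partial_sum m v = partial_sum m w) -> v = w.
Proof.
move=> vw; apply/rowP => j; rewrite !coord_partial_sum vw; last by rewrite ltn_ord.
have [->|j0] := posnP (val j); first by rewrite !partial_sum_0.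
by rewrite vw // j0 /= ltnW.
Qed.

Lemma partial_sum_basis (R : realType) (r k m : nat) : (1 <= k <= r.+1)%N ->
  partial_sum m (std_basis R r k) = ((k <= m)%N%:R)%R.
Proof.
move=> kr; rewrite /partial_sum /std_basis; have [km|mk] := leqP k m.
  rewrite (bigD1 (inord k.-1)) /=; last by rewrite inordK; lia.
  by rewrite mxE !eqxx big1 ?addr0 // => j /andP[_ /negPf jk]; rewrite mxE jk andbF.
apply: big1 => j jm; rewrite mxE; have [jk|_] := eqVneq j; last by rewrite andbF.
by exfalso; move: jm; rewrite jk inordK; lia.
Qed.

Lemma partial_sum_simple_root (R : realType) (r k m : nat) : (1 <= k <= r)%N ->
  partial_sum m (simple_root R r k) = ((m == k)%:R)%R.
Proof.
move=> kr; rewrite /simple_root partial_sumD partial_sumN !partial_sum_basis; try lia.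
by case: (ltngtP k m) => _; rewrite ?subrr ?subr0.
Qed.

Lemma partial_sum_pos_root (R : realType) (r : nat) (a : pos_index r) (m : nat) : (1 <= m)%N ->
  partial_sum m (pos_root R a) = (((val a).1 <= m <= (val a).2)%N%:R)%R.
Proof.
rewrite /pos_root; case: a => -[i j] /= /andP[i1 ij] m1.
rewrite partial_sum_sum big_nat.
rewrite (eq_bigr (fun k => (if k == m then 1%N else 0%N)%:R)%R); last first.
  move=> k kr; rewrite partial_sum_simple_root; last by have := ltn_ord j; lia.
  by rewrite eq_sym; case: eqP.
rewrite -natr_sum -big_nat -big_mkcond big_nat1_eq ltnS.
by case: ifP.
Qed.

(** Positive roots are sums of simple roots, and simple roots are positive, so both
    generate the same semigroup, in which the coefficients can be read off. *)
Lemma kostant_gt0 (R : realType) (r : nat) (xi : 'rV[R]_r.+1) :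
  (0 < kostant xi)%N <-> exists c : nat -> nat,
     (forall m, (1 <= m <= r)%N -> partial_sum m xi = (c m)%:R%R) /\
     partial_sum r.+1 xi = 0%R.
Proof.
have -> : (0 < kostant xi)%N <-> exists m, kostant_partitions xi m.
  rewrite cardfs_gt0; split=> [/fset0Pn[m]|[m xi_m]].
    by rewrite in_fset_set ?inE //; [exists m|exact: finite_kostant_partitions].
  apply/fset0Pn; exists m; rewrite in_fset_set ?inE //.
  exact: finite_kostant_partitions.
split=> [[m <-]|[c [xi_c xi_r]]].
  exists (fun k => \sum_(a : pos_index r) ((val a).1 <= k <= (val a).2)%N * m a).
  split=> [k kr|]; rewrite partial_sum_sum.
    rewrite natr_sum; apply: eq_bigr => a _.
    by rewrite partial_sumMn partial_sum_pos_root ?natrM ?mulr_natr //; case/andP: kr.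
  apply: big1 => a _; rewrite partial_sumMn partial_sum_pos_root //.
  by rewrite [(r < _)%N]leqNgt ltn_ord andbF mul0rn.
exists [ffun a : pos_index r => ((val a).1 == (val a).2) * c (val a).1].
apply: partial_sum_inj => m /andP[m1 mr]; rewrite partial_sum_sum.
under eq_bigr do rewrite partial_sumMn partial_sum_pos_root // ffunE -mulrnA.
move: mr; rewrite leq_eqVlt ltnS => /predU1P[->|mr].
  by rewrite xi_r big1 // => a _; rewrite [(r < _)%N]leqNgt ltn_ord andbF.
pose p : 'I_r.+1 * 'I_r.+1 := (inord m, inord m).
have mm : (0 < p.1 <= p.2)%N by rewrite /= inordK // m1 leqnn.
rewrite xi_c ?m1 // (bigD1 (exist _ p mm : pos_index r)) //= eqxx mul1n inordK // leqnn mul1n.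
rewrite big1 ?addr0 // => -[[i j] ij]; rewrite -val_eqE /= xpair_eqE => neq_mm.
have [ij_eq|] := eqVneq i j; last by rewrite muln0.
rewrite mul1n; case: andP => // -[im mj]; case/negP: neq_mm; rewrite -ij_eq andbb.
by apply/eqP/val_inj; rewrite /= inordK //; move: mj; rewrite -ij_eq; lia.
Qed.

Lemma sum_ord_interval (n a b : nat) : (\sum_(i < n) (a <= i < b) = minn b n - a)%N.
Proof.
elim: n => [|n IH]; first by rewrite big_ord0; lia.
by rewrite big_ord_recr /= IH; case: (boolP (a <= n < b)%N); lia.
Qed.

(** The coefficient of alpha_m counts the pairs (i, j) with i <= m <= j. *)
Lemma partial_sum_double_rho (R : realType) (r m : nat) : (m <= r.+1)%N ->
  partial_sum m (\sum_(a : pos_index r) pos_root R a)%R = (m * (r.+1 - m))%:R%R.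
Proof.
have [->|m1] := posnP m; first by rewrite partial_sum_0 mul0n.
move=> mr; rewrite partial_sum_sum.
under eq_bigr do rewrite partial_sum_pos_root //.
rewrite -natr_sum; congr (_%:R)%R.
rewrite -(big_sub (fun p : 'I_r.+1 * 'I_r.+1 => (0 < p.1 <= p.2)%N)
                  (fun p => nat_of_bool (p.1 <= m <= p.2)%N)).
rewrite big_mkcond /= (eq_bigr (fun p : 'I_r.+1 * 'I_r.+1 =>
    (1 <= p.1 < m.+1)%N * (m <= p.2 < r.+1)%N)); last first.
  move=> [i j] _; rewrite [_ \in _]/(0 < i <= j)%N /= ltn_ord andbT ltnS.
  case: (ltnP 0 i) => //= _.
  by case: (leqP i m); case: (leqP m j); case: (leqP i j) => //=; lia.
rewrite -(pair_bigA _ (fun i j : 'I_r.+1 => (1 <= i < m.+1)%N * (m <= j < r.+1)%N)) /=.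
under eq_bigr do rewrite -big_distrr /=.
rewrite -big_distrl /= !sum_ord_interval minnn.
by have [->|mr'] := eqVneq m r.+1; [rewrite subnn !muln0 | congr (_ * _); lia].
Qed.

Lemma rho_coord (R : realType) (r : nat) (j : 'I_r.+1) :
  (rho R r 0 j = r%:R / 2 - j%:R)%R.
Proof.
have jr : (j <= r)%N by rewrite -ltnS.
rewrite /rho mxE coord_partial_sum !partial_sum_double_rho ?ltn_ord ?leqW //.
rewrite subSS !natrM !natrB ?leqW // -!natr1.
by field.
Qed.

Lemma highest_root_coord (R : realType) (r : nat) (j : 'I_r.+1) : (1 <= r)%N ->
  (highest_root R r 0 j = (j == ord0)%:R - (j == ord_max)%:R)%R.
Proof.
move=> r1; rewrite /highest_root; under eq_bigr do rewrite /simple_root -opprB.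
rewrite sumrN telescope_sumr // opprB /std_basis !mxE /=.
by rewrite (_ : inord 0 = ord0) 1?(_ : inord r = ord_max) //; apply/val_inj; rewrite /= inordK.
Qed.

(** Nonnegativity of the coefficient of alpha_m in
    s(highest root + rho) + highest root - rho, with the negative terms moved to
    the left-hand side.  The condition sees s only through the set of y such that
    s y < m. *)
Definition allowable_at (r : nat) (s : 'S_r.+1) (m : nat) : Prop :=
  (\sum_(y < r.+1 | s y < m) y + (s ord_max < m) <= 1 + (s ord0 < m) + \sum_(j < m) j)%N.

Lemma partial_sum_weyl_act (R : realType) (r m : nat) (s : 'S_r.+1) (v : 'rV[R]_r.+1) :
  (partial_sum m (weyl_act s v) = \sum_(y < r.+1 | (s y < m)%N) v 0 y)%R.
Proof.
rewrite /partial_sum (reindex_inj (@perm_inj _ s)) /=.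
by apply: eq_bigr => y _; rewrite mxE permK.
Qed.

Lemma partial_sum_act_rho (R : realType) (r m : nat) (s : 'S_r.+1) : (m <= r.+1)%N ->
  (partial_sum m (weyl_act s (rho R r)) - partial_sum m (rho R r)
   = (\sum_(j < m) j)%N%:R - (\sum_(y < r.+1 | s y < m) y)%N%:R)%R.
Proof.
move=> mr; rewrite partial_sum_weyl_act /partial_sum.
under eq_bigr do rewrite rho_coord; under [X in (_ - X)%R]eq_bigr do rewrite rho_coord.
rewrite !big_split /= !sumrN -!natr_sum.
rewrite [X in ((_ - _) - (X - _))%R](reindex_inj (@perm_inj _ s)) /=.
rewrite (big_ord_widen _ id mr).
ring.
Qed.

(** The term [(r < m)] is there for m = r.+1, where the first m coordinates include
    the last coordinate -1 of the highest root. *)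
Lemma partial_sum_weight (R : realType) (r m : nat) (s : 'S_r.+1) : (1 <= r)%N ->
    (1 <= m <= r.+1)%N ->
  (partial_sum m (weyl_act s (highest_root R r + rho R r) - - highest_root R r - rho R r)
   = (1 + (s ord0 < m)%N + \sum_(j < m) j)%N%:R
     - (\sum_(y < r.+1 | s y < m) y + (s ord_max < m)%N + (r < m))%N%:R)%R.
Proof.
move=> r1 /andP[m1 mr].
have hr t : (\sum_(y < r.+1 | (t y < m)%N) highest_root R r 0 y
             = (t ord0 < m)%N%:R - (t ord_max < m)%N%:R)%R.
  under eq_bigr do rewrite highest_root_coord //.
  rewrite big_split /= sumrN; congr (_ - _)%R; rewrite big_mkcond.
    rewrite (bigD1 ord0) //= ?eqxx big1 ?addr0 => [|i /negPf->]; last by case: ifP.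
    by case: ifP.
  rewrite (bigD1 ord_max) //= ?eqxx big1 ?addr0 => [|i /negPf->]; last by case: ifP.
  by case: ifP.
have actD (v w : 'rV[R]_r.+1) : (weyl_act s (v + w) = weyl_act s v + weyl_act s w)%R.
  by apply/rowP => j; rewrite !mxE.
rewrite actD opprK !partial_sumD partial_sumN.
rewrite partial_sum_weyl_act hr [partial_sum m (highest_root R r)](hr (@id 'I_r.+1)) /= m1.
have := partial_sum_act_rho R s mr.
rewrite !natrD /= => E.
rewrite -(addrA _ _ (- _)%R) in E *.
lra.
Qed.

Lemma alternation_setP (R : realType) (r : nat) (s : 'S_r.+1) : (1 <= r)%N ->
  s \in alternation_set (highest_root R r) (- highest_root R r)%R <->
  forall m, (1 <= m <= r)%N -> allowable_at s m.
Proof.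
move=> r1; rewrite inE weyl_groupT inE /= kostant_gt0; split=> [[c [c_m _]] m mr|ok].
  have m1r : (1 <= m <= r.+1)%N by lia.
  have := c_m m mr; rewrite partial_sum_weight // /allowable_at.
  have -> : (r < m)%N = false by lia.
  rewrite addn0 => /eqP; rewrite subr_eq -natrD eqr_nat => /eqP ->.
  exact: leq_addl.
exists (fun m => (1 + (s ord0 < m)%N + \sum_(j < m) j)%N -
   (\sum_(y < r.+1 | s y < m) y + (s ord_max < m)%N)%N); split=> [m mr|].
  rewrite partial_sum_weight //; last by lia.
  have -> : (r < m)%N = false by lia.
  by rewrite addn0 natrB //; exact: ok.
rewrite partial_sum_weight ?leqnn // !ltn_ord.
have -> : (\sum_(y < r.+1 | s y < r.+1) y = \sum_(y < r.+1) y)%N.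
  by apply: eq_bigl => y; rewrite ltn_ord.
by rewrite addnAC -addnA [(_ + (_ + _))%N]addnC subrr.
Qed.

(** * Decomposition into blocks *)

(** Independence means that crossed indices of s and t are neither equal nor
    adjacent. *)
Lemma independentP (r : nat) (s t : 'S_r.+1) :
  independent s t <->
  forall i j, crosses s i -> crosses t j -> (i.+1 < j)%N || (j.+1 < i)%N.
Proof.
split=> [st i j s_i t_j|st].
  apply: contraPT st; rewrite negb_or -!leqNgt => /andP[ji ij] st.
  suff : (influence s `&` ext_influence t)%classic i by rewrite st.
  split; first exact/influenceE.
  split; first exact: crosses_range s_i.
  have [->|neq_ij] := eqVneq i j; first by left; exact/influenceE.
  by right; exists j; [exact/influenceE | rewrite /dynkin_adj; lia].
apply/seteqP; split=> // i [/influenceE s_i [_]].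
case=> [/influenceE t_i|[j /influenceE t_j]]; first by have := st _ _ s_i t_i; lia.
by rewrite /dynkin_adj; have := st _ _ s_i t_j; lia.
Qed.

Lemma independent_fix (r : nat) (s t : 'S_r.+1) (x : 'I_r.+1) :
  independent s t -> s x != x -> t x = x.
Proof.
move=> /independentP st sx; apply/eqP; apply: contraTT isT => tx.
have [|] := crosses_moved sx; have [|] := crosses_moved tx => t_x s_x;
  by have := st _ _ s_x t_x; lia.
Qed.

(** Permutations with pairwise disjoint supports: whatever the order of the
    factors, their product acts at each point as the one factor moving it.  This
    replaces reordering arguments for a product in a noncommutative group. *)
Lemma prod_disjoint (T : finType) (l : seq {perm T}) (x : T) : uniq l ->
    (forall (a b : {perm T}) (y : T), a \in l -> b \in l -> a != b -> a y != y -> b y = y) ->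
  (forall a : {perm T}, a \in l -> a x != x -> (\prod_(b <- l) b)%g x = a x) /\
  ((forall a : {perm T}, a \in l -> a x = x) -> (\prod_(b <- l) b)%g x = x).
Proof.
elim: l x => [|c l IH] x /=; first by move=> _ _; split=> // _; rewrite big_nil perm1.
case/andP=> c_l l_uniq disj.
have {}IH y := IH y l_uniq (fun a b y al bl =>
  disj a b y (@mem_behead _ (c :: l) a al) (@mem_behead _ (c :: l) b bl)).
rewrite big_cons permM; split=> [a|fix_x]; last first.
  rewrite fix_x ?mem_head //; apply: (IH x).2 => a al.
  by apply: fix_x; rewrite inE al orbT.
rewrite inE => /predU1P[->|al] ax.
  apply: (IH (c x)).2 => b bl; apply: (disj c b); rewrite ?mem_head ?inE ?bl ?orbT //.
    by apply: contraNneq c_l => ->.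
  by rewrite (inj_eq perm_inj).
have -> : c x = x.
  apply: (disj a c); rewrite ?mem_head ?inE ?al ?orbT //.
  by apply: contraNneq c_l => <-.
exact: (IH x).1.
Qed.

Lemma prod_independent (r : nat) (T : {set 'S_r.+1}) (x : 'I_r.+1) :
    pairwise_independent T ->
  (forall a, a \in T -> a x != x -> (\prod_(b in T) b)%g x = a x) /\
  ((forall a, a \in T -> a x = x) -> (\prod_(b in T) b)%g x = x).
Proof.
move=> T_ind; rewrite -big_filter; set l := seq.filter _ _.
have mem_l a : (a \in l) = (a \in T) by rewrite mem_filter mem_index_enum andbT.
have [||mv fx] := @prod_disjoint _ l x; first by rewrite filter_uniq ?index_enum_uniq.
  move=> a b y; rewrite !mem_l => aT bT /eqP neq_ab.
  exact/independent_fix/T_ind.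
split=> [a aT|fix_x]; first by apply: mv; rewrite mem_l.
by apply: fx => a; rewrite mem_l; exact: fix_x.
Qed.

Lemma dynkin_up (i n : nat) : exists p, [/\ path dynkin_adj i p, last i p = i + n
  & {in p, forall k, (i <= k <= i + n)%N}].
Proof.
elim: n i => [|n IH] i; first by exists [::]; rewrite addn0.
have [p [ip lst p_in]] := IH i.+1; exists (i.+1 :: p); split.
- by rewrite /= ip /dynkin_adj eqxx.
- by rewrite /= lst; lia.
- by move=> k; rewrite inE => /predU1P[->|/p_in]; lia.
Qed.

Lemma dynkin_down (i n : nat) : (n <= i)%N ->
  exists p, [/\ path dynkin_adj i p, last i p = i - n
  & {in p, forall k, (i - n <= k <= i)%N}].
Proof.
elim: n i => [|n IH] i ni; first by exists [::]; rewrite subn0.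
have [|p [ip lst p_in]] := IH i.-1; first by lia.
exists (i.-1 :: p); split.
- by rewrite /= ip /dynkin_adj andbT; lia.
- by rewrite /= lst; lia.
- by move=> k; rewrite inE => /predU1P[->|/p_in]; lia.
Qed.

(** Steps of a path in the Dynkin diagram have length 1, so no intermediate value
    can be skipped. *)
Lemma path_crosses_between (i m : nat) (p : seq nat) : path dynkin_adj i p ->
  (i <= m <= last i p)%N -> m \in i :: p.
Proof.
elim: p i => [|j p IH] i /=; first by rewrite inE; lia.
case/andP=> ij /IH{}IH m_in; rewrite inE; have [//|neq] := eqVneq m i.
by apply: IH; move: ij; rewrite /dynkin_adj; lia.
Qed.

Lemma connected_influenceP (r : nat) (s : 'S_r.+1) :
  dynkin_connected (influence s) <->
  forall i m j, (i <= m <= j)%N -> crosses s i -> crosses s j -> crosses s m.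
Proof.
split=> [conn i m j imj s_i s_j|convex i j /influenceE s_i /influenceE s_j].
  have [||p [ip lst p_in]] := conn i j; try exact/influenceE.
  have := path_crosses_between (m := m) ip; rewrite lst inE => /(_ imj).
  by case/predU1P => [-> //|/p_in /influenceE].
have [ij|/ltnW ji] := leqP i j.
  have [p [ip lst p_in]] := dynkin_up i (j - i); exists p; split=> //; first by lia.
  move=> k /p_in k_in; apply/influenceE/(convex i k j) => //.
  by move: k_in; lia.
have [|p [ip lst p_in]] := @dynkin_down i (i - j); first by lia.
exists p; split=> //; first by lia.
move=> k /p_in k_in; apply/influenceE/(convex j k i) => //.
by move: k_in; lia.
Qed.

(** The points that no uncrossed index separates from x. *)
Definition block (r : nat) (s : 'S_r.+1) (x : 'I_r.+1) : {set 'I_r.+1} :=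
  [set y : 'I_r.+1 | [forall m : 'I_r.+2, ~~ crosses s m ==> ((x < m)%N == (y < m)%N)]].

Lemma blockP (r : nat) (s : 'S_r.+1) (x y : 'I_r.+1) :
  reflect (forall m, ~~ crosses s m -> (x < m)%N = (y < m)%N) (y \in block s x).
Proof.
rewrite inE; apply: (iffP forallP) => [xy m nc|xy m]; last first.
  by apply/implyP => /xy->.
have [mr|rm] := ltnP m r.+2; first by have /implyP/(_ nc)/eqP := xy (Ordinal mr).
by have := ltn_ord x; have := ltn_ord y; lia.
Qed.

Lemma block_sep (r : nat) (s : 'S_r.+1) (x y : 'I_r.+1) :
  y \notin block s x -> exists2 m, ~~ crosses s m & (x < m)%N != (y < m)%N.
Proof. by rewrite inE negb_forall => /existsP[m]; rewrite negb_imply => /andP[]; exists m. Qed.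

Lemma block_stable (r : nat) (s : 'S_r.+1) (x y : 'I_r.+1) :
  (s y \in block s x) = (y \in block s x).
Proof. by apply/blockP/blockP => xy m nc; rewrite xy // uncrossed_lt. Qed.

Definition block_perm (r : nat) (s : 'S_r.+1) (x : 'I_r.+1) : 'S_r.+1 :=
  restr_perm (block s x) s.

Lemma block_permE (r : nat) (s : 'S_r.+1) (x y : 'I_r.+1) :
  block_perm s x y = if y \in block s x then s y else y.
Proof.
case: ifPn => [y_in|y_out]; last exact: out_perm (restr_perm_on _ _) y_out.
apply: restr_permE => //; rewrite !inE; apply/fintype.subsetP => z z_in.
by rewrite inE /= block_stable.
Qed.

Lemma crosses_block (r : nat) (s : 'S_r.+1) (x : 'I_r.+1) (m : nat) :
  crosses (block_perm s x) m ->
  exists y, [/\ y \in block s x, s y \in block s x & (y < m <= s y)%N].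
Proof.
case/existsP=> y; rewrite block_permE; case: ifP => [y_in ym|_]; last by lia.
by exists y; rewrite block_stable.
Qed.

(** A point outside the block is cut off from it by an uncrossed index, and s
    keeps it on its side, whereas m falls strictly inside the block. *)
Lemma crosses_block_lt (r : nat) (s : 'S_r.+1) (x y : 'I_r.+1) (m : nat) :
  crosses (block_perm s x) m -> y \notin block s x -> (s y < m)%N = (y < m)%N.
Proof.
case/crosses_block => z [z_in sz_in zm] /block_sep[c nc sep].
have := uncrossed_lt y nc; have := blockP _ _ _ z_in c nc; have := blockP _ _ _ sz_in c nc.
by move/eqP: sep; lia.
Qed.

(** The restriction of s to a block crosses every index interior to that block:
    otherwise s itself would not cross it, and the block would be cut there. *)
Lemma crosses_blockP (r : nat) (s : 'S_r.+1) (x : 'I_r.+1) (m : nat) :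
  crosses (block_perm s x) m <->
  exists2 p : 'I_r.+1 * 'I_r.+1, [/\ p.1 \in block s x & p.2 \in block s x]
     & (p.1 < m <= p.2)%N.
Proof.
split=> [/crosses_block[y [y_in sy_in ym]]|[[y z] /= [y_in z_in] ymz]]; first by exists (y, s y).
apply: contraT => nc; suff s_m : ~~ crosses s m.
  by have := blockP _ _ _ y_in m s_m; have := blockP _ _ _ z_in m s_m; lia.
apply/existsPn => t; apply/negP => tm.
have [t_in|t_out] := boolP (t \in block s x).
  by case/negP: nc; apply/existsP; exists t; rewrite block_permE t_in.
have [c c_nc sep] := block_sep t_out.
have := uncrossed_lt t c_nc; have := blockP _ _ _ y_in c c_nc; have := blockP _ _ _ z_in c c_nc.
by move/eqP: sep; lia.
Qed.

Lemma connected_block (r : nat) (s : 'S_r.+1) (x : 'I_r.+1) :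
  dynkin_connected (influence (block_perm s x)).
Proof.
apply/connected_influenceP => i m j imj /crosses_blockP[[a b] /= [a_in b_in] iab].
case/crosses_blockP=> [[c d] /= [c_in d_in] jcd].
by apply/crosses_blockP; exists (a, d) => //=; lia.
Qed.

(** Distinct blocks are separated by an uncrossed index m; the crossed indices of
    the two restrictions lie on either side of m, so that they differ by at least
    2. *)
Lemma independent_block (r : nat) (s : 'S_r.+1) (x y : 'I_r.+1) :
  block_perm s x <> block_perm s y -> independent (block_perm s x) (block_perm s y).
Proof.
move=> neq; have : y \notin block s x.
  apply/negP => /blockP xy; apply: neq; congr (restr_perm _ s); apply/setP => z.
  by apply/blockP/blockP => eq_z m nc; rewrite -?xy // ?eq_z // xy // eq_z.
case/block_sep => m nc sep; apply/independentP => i j.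
case/crosses_blockP=> [[a b] /= [a_in b_in] iab].
case/crosses_blockP=> [[c d] /= [c_in d_in] jcd].
have := blockP _ _ _ a_in m nc; have := blockP _ _ _ b_in m nc.
have := blockP _ _ _ c_in m nc; have := blockP _ _ _ d_in m nc.
by move/eqP: sep; lia.
Qed.

Definition blocks (r : nat) (s : 'S_r.+1) : {set 'S_r.+1} :=
  [set block_perm s x | x : 'I_r.+1] :\ 1%g.

Lemma pairwise_independent_blocks (r : nat) (s : 'S_r.+1) : pairwise_independent (blocks s).
Proof.
move=> a b /setD1P[_ /imsetP[x _ ->]] /setD1P[_ /imsetP[y _ ->]].
exact: independent_block.
Qed.

Lemma prod_blocks (r : nat) (s : 'S_r.+1) : (\prod_(b in blocks s) b)%g = s.
Proof.
apply/permP => x.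
have [mv fx] := prod_independent x (@pairwise_independent_blocks r s).
have x_in : x \in block s x by exact/blockP.
have [sx|sx] := eqVneq (s x) x.
  rewrite fx // => a /setD1P[_ /imsetP[y _ ->]]; rewrite block_permE sx.
  by case: ifP.
have bx : block_perm s x x = s x by rewrite block_permE x_in.
rewrite (mv (block_perm s x)) ?bx //.
apply/setD1P; split; last exact: imset_f.
by apply: contraNneq sx => b1; rewrite -bx b1 perm1.
Qed.

(** The crossed indices of the product are those of the factors, and indices of
    different factors are never adjacent; so a path inside the influence of b
    never leaves the influence of the factor in which it starts. *)
Lemma connected_prod (r : nat) (T : {set 'S_r.+1}) (b : 'S_r.+1) :
    pairwise_independent T -> b != 1%g ->
    dynkin_connected (influence b) -> b = (\prod_(t in T) t)%g ->
  b \in T.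
Proof.
move=> T_ind b1 b_conn b_prod.
have crosses_sub t m : t \in T -> crosses t m -> crosses b m.
  move=> tT /existsP[x xm]; apply/existsP; exists x.
  by rewrite b_prod (proj1 (prod_independent x T_ind) t) // -val_eqE /=; lia.
have sub_crosses m : crosses b m -> exists2 t, t \in T & crosses t m.
  case/existsP=> x xm; have [/existsP[t /andP[tT tx]]|/existsPn no_t] :=
      boolP [exists t : 'S_r.+1, (t \in T) && (t x != x)].
    exists t => //; apply/existsP; exists x.
    by rewrite -(proj1 (prod_independent x T_ind) t) // -b_prod.
  move: xm; rewrite b_prod (proj2 (prod_independent x T_ind)); first by lia.
  by move=> t tT; apply/eqP; have := no_t t; rewrite tT negbK.
have [m b_m] := crosses_neq1 b1; have [t tT t_m] := sub_crosses m b_m.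
have t_path p i : path dynkin_adj i p -> (forall k, k \in p -> influence b k) ->
    crosses t i -> crosses t (last i p).
  elim: p i => [|j p IH] i //= /andP[ij jp] p_b t_i; apply: IH => //.
    by move=> k kp; apply: p_b; rewrite inE kp orbT.
  have [|t' t'T t'_j] := sub_crosses j; first by apply/influenceE/p_b/mem_head.
  have [<- //|/eqP neq] := eqVneq t' t.
  have /independentP/(_ _ _ t'_j t_i) := T_ind _ _ t'T tT neq.
  by move: ij; rewrite /dynkin_adj; lia.
have t_all j : crosses b j -> crosses t j.
  move=> b_j; have [||p [mp <- p_b]] := b_conn m j; try exact/influenceE.
  exact: t_path.
suff -> : b = t by [].
apply/permP => x; rewrite b_prod; have [mv fx] := prod_independent x T_ind.
have [tx|tx] := eqVneq (t x) x; last exact: mv.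
rewrite tx; apply: fx => t' t'T; have [-> //|/eqP neq] := eqVneq t' t.
apply/eqP; apply: contraT => t'x.
have [k t'_k] : exists k, crosses t' k.
  by case: (crosses_moved t'x); [exists x|exists x.+1].
have /independentP/(_ _ _ t'_k (t_all _ (crosses_sub _ _ t'T t'_k))) := T_ind _ _ t'T tT neq.
by lia.
Qed.

(** The restrictions to blocks provide the required factorizations, and a connected
    element of the alternation set, being a product of elements of S, belongs to S
    by [connected_prod]. *)
Lemma is_BAS_iff (R : realType) (r : nat) (lam mu : 'rV[R]_r.+1) (S : {set 'S_r.+1}) :
    (forall s x, s \in alternation_set lam mu -> block_perm s x \in alternation_set lam mu) ->
  is_BAS lam mu S <->
  forall b, b \in S <->
    [/\ b \in alternation_set lam mu, b != 1%g & dynkin_connected (influence b)].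
Proof.
move=> A_block; split=> [[S_A S1 S_conn S_prod] b|S_E].
  split=> [bS|[b_A b1 b_conn]].
    split; [exact: (fintype.subsetP S_A) | | exact: S_conn].
    by apply: contraNneq S1 => <-.
  have [T [T_S T_ind b_T]] := S_prod b b_A; apply: (fintype.subsetP T_S).
  exact: connected_prod.
split.
- by apply/fintype.subsetP => b /S_E[].
- by apply/negP => /S_E[_]; rewrite eqxx.
- by move=> b /S_E[].
move=> s s_A; exists (blocks s); split; last by rewrite prod_blocks.
  apply/fintype.subsetP => b /setD1P[b1 /imsetP[x _ b_x]]; apply/S_E; split=> //.
    by rewrite b_x; exact: A_block.
  by rewrite b_x; exact: connected_block.
exact: pairwise_independent_blocks.
Qed.

(** Where the restriction crosses m, it sends the same points below m as s does;
    where it does not, these points are 0, ..., m-1, and r is not among them. *)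
Lemma allowable_block (r : nat) (s : 'S_r.+1) (x : 'I_r.+1) (m : nat) : (m <= r)%N ->
  allowable_at s m -> allowable_at (block_perm s x) m.
Proof.
move=> mr; rewrite /allowable_at; have [b_m|nc _] := boolP (crosses (block_perm s x) m).
  have eq_lt y : (block_perm s x y < m)%N = (s y < m)%N.
    rewrite block_permE; case: ifPn => // y_out.
    by rewrite (crosses_block_lt b_m).
  by rewrite (eq_bigl _ _ eq_lt) !eq_lt.
rewrite (eq_bigl _ _ (fun y => uncrossed_lt y nc)).
rewrite !uncrossed_lt //= (_ : (r < m)%N = false); last by lia.
by rewrite (big_ord_widen _ id (leqW mr)) addn0 leq_addl.
Qed.

(** * Classification of the connected allowable elements *)

Lemma nat_swap_spec (k j : nat) :
  j = k.-1 /\ nat_swap k j = k \/ j = k /\ nat_swap k j = k.-1 \/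
  j <> k.-1 /\ j <> k /\ nat_swap k j = j.
Proof. by rewrite /nat_swap; do 2?case: eqP; lia. Qed.

Lemma uncrossed_nat (r : nat) (s : 'S_r.+1) (m j : nat) :
  ~~ crosses s m -> (nat_perm s j < m)%N = (j < m)%N.
Proof.
move=> nc; have [jr|rj] := leqP j r; last by rewrite nat_perm_out.
by have := uncrossed_lt (inord j) nc; rewrite -nat_permE inordK.
Qed.

Lemma uncrossed_fix (r : nat) (s : 'S_r.+1) (j : nat) :
  ~~ crosses s j -> ~~ crosses s j.+1 -> nat_perm s j = j.
Proof. by move=> /(uncrossed_nat j) + /(uncrossed_nat j); lia. Qed.

Lemma sum_below (r : nat) (s : 'S_r.+1) (m : nat) : (m <= r.+1)%N ->
  (\sum_(y < r.+1 | s y < m) y = \sum_(j < m) nat_perm s^-1 j)%N.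
Proof.
move=> mr; rewrite (big_ord_widen _ (nat_perm s^-1%g) mr).
rewrite [RHS](reindex_inj (@perm_inj _ s)) /=.
by apply: eq_bigr => y _; rewrite -nat_permE nat_permK.
Qed.

(** Here d is the excess of the inverse permutation at m. *)
Lemma allowable_at_excess (r : nat) (s : 'S_r.+1) (m d : nat) : (1 <= m <= r)%N ->
    (\sum_(j < m) nat_perm s^-1 j = \sum_(j < m) j + d)%N ->
  allowable_at s m <->
  (d + (nat_perm s r < m) <= 1 + (nat_perm s 0 < m))%N.
Proof.
move=> mr sum_d; rewrite /allowable_at sum_below; last by lia.
rewrite sum_d -[nat_of_ord (s ord_max)]nat_permE -[nat_of_ord (s ord0)]nat_permE /=.
by rewrite -addnA addnC leq_add2r.
Qed.

Lemma excess_uncrossed (r : nat) (s : 'S_r.+1) (m : nat) : (m <= r.+1)%N ->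
  ~~ crosses s m -> (\sum_(j < m) nat_perm s^-1 j = \sum_(j < m) j + 0)%N.
Proof.
move=> mr nc; rewrite -sum_below // (eq_bigl _ _ (fun y => uncrossed_lt y nc)).
by rewrite addn0 (big_ord_widen _ id mr).
Qed.

Lemma excess_step (t : nat -> nat) (m d e : nat) :
    (\sum_(j < m) t j = \sum_(j < m) j + d)%N -> (d + t m = e + m)%N ->
  (\sum_(j < m.+1) t j = \sum_(j < m.+1) j + e)%N.
Proof. by move=> sum_d de; rewrite !big_ord_recr /= sum_d -!addnA de [(m + e)%N]addnC. Qed.

Lemma nat_perm_word (r : nat) (w : seq nat) (j : nat) : is_word r w ->
  nat_perm (word_elt r w) j = foldr nat_swap j w.
Proof.
elim: w => [_|k w IH /= /andP[kr /IH <-]]; first exact: nat_perm1.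
exact: nat_perm_simple_mul.
Qed.

(* Evaluates nested swaps from the inside, discarding impossible cases at once:
   without this pruning the case analysis is too large for [lia]. *)
Ltac swap_lia :=
  rewrite /=;
  repeat match goal with |- context [nat_swap ?k ?j] =>
    lazymatch j with
    | context [nat_swap _ _] => fail
    | _ => case: (nat_swap_spec k j) => [[? ->]|[[? ->]|[? [? ->]]]]; try (exfalso; lia)
    end end;
  lia.

(** Think of t as the inverse of s, with k the last uncrossed index before the
    first crossed one.  The values below k being used up, t k, t (k+1), ... are
    distinct and at least k, and the bound on the excess caps each of them from
    above; two possibilities at most are left at each step, and the process stops
    when the excess returns to 0.  An excess of 2 requires s 0 < m, which excludes
    k = 0, and m <= s r, which excludes that r is among the values t 0, ...,
    t (m-1). *)
Lemma excess_shapes (r k : nat) (s t : nat -> nat) : (k < r)%N ->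
    cancel s t -> cancel t s -> (forall j, (j <= r)%N -> (t j <= r)%N) ->
    (forall j, (k <= j)%N -> (k <= t j)%N) -> t k <> k ->
    (\sum_(j < k) t j = \sum_(j < k) j + 0)%N ->
    (forall m d, (1 <= m <= r)%N -> (\sum_(j < m) t j = \sum_(j < m) j + d)%N ->
      (d + (s r < m) <= 1 + (s 0 < m))%N) ->
  [\/ [/\ t k = k.+1 & t k.+1 = k],
      [/\ (1 <= k)%N, (k + 3 <= r)%N, t k = k.+1, t k.+1 = k.+2 & t k.+2 = k] |
      [/\ (1 <= k)%N, (k + 3 <= r)%N & t k = k.+2] /\
      [\/ [/\ t k.+1 = k & t k.+2 = k.+1],
          [/\ t k.+1 = k.+1 & t k.+2 = k] |
          [/\ (k + 4 <= r)%N, t k.+1 = k, t k.+2 = k.+3 & t k.+3 = k.+1] ] ].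
Proof.
move=> kr ts st t_le ge t_k ex_k H.
have neq i j : i <> j -> t i <> t j by move=> ij /(can_inj st).
have s_eq i j : t i = j -> s j = i by move=> <-; exact: st.
have no_zero m : (forall i, (i < m)%N -> t i <> 0) -> (s 0 < m)%N = false.
  by move=> nz; apply/negP => /nz; rewrite ts.
have top i m : (i < m)%N -> (s r < m)%N = false -> t i <> r.
  by move=> im + /s_eq si; rewrite si im.
have ge0 := ge k (leqnn k); have ge1 := ge k.+1 (leqnSn k).
have ge2 : (k <= t k.+2)%N by apply: ge; lia.
have ge3 : (k <= t k.+3)%N by apply: ge; lia.
have n01 : t k <> t k.+1 by apply: neq; lia.
have n02 : t k <> t k.+2 by apply: neq; lia.
have n12 : t k.+1 <> t k.+2 by apply: neq; lia.
have n03 : t k <> t k.+3 by apply: neq; lia.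
have n13 : t k.+1 <> t k.+3 by apply: neq; lia.
have n23 : t k.+2 <> t k.+3 by apply: neq; lia.
have le0 := t_le k (ltnW kr); have le1 := t_le k.+1 kr.
have d1 : (\sum_(j < k.+1) t j = \sum_(j < k.+1) j + (t k - k))%N.
  by apply: excess_step ex_k _; lia.
have h1 := H k.+1 _ kr d1.
(* An excess of 2 already at k.+1 is the second case. *)
have [tk|tk] : t k = k.+1 \/ t k = k.+2 by lia.
  have t1 : t k.+1 = k \/ t k.+1 = k.+2.
    have [r_eq|kr1] : k.+1 = r \/ (k.+2 <= r)%N by lia.
      by lia.
    have d2 : (\sum_(j < k.+2) t j = \sum_(j < k.+2) j + (t k.+1 - k))%N.
      by apply: excess_step d1 _; lia.
    by have := H k.+2 _ kr1 d2; lia.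
  case: t1 => t1; first by constructor 1.
  have kr1 : (k.+2 <= r)%N by lia.
  have d2 : (\sum_(j < k.+2) t j = \sum_(j < k.+2) j + 2)%N.
    by apply: excess_step d1 _; lia.
  have h2 := H k.+2 _ kr1 d2.
  have r_k2 := top k.+1 k.+2 (leqnn _); have kr2 : (k.+3 <= r)%N by lia.
  have d3 : (\sum_(j < k.+3) t j = \sum_(j < k.+3) j + (t k.+2 - k))%N.
    by apply: excess_step d2 _; lia.
  have h3 := H k.+3 _ kr2 d3.
  constructor 2; split; try lia.
  (* For k = 0 the excess 2 at 2 would come from the values 1, 2, without 0. *)
  case: (posnP k) => // k0; exfalso; move: tk t1 h2; rewrite k0 => tk t1.
  by rewrite no_zero; [lia | case=> [|[|//]] _; lia].
have h1' : (s 0 < k.+1)%N /\ (s r < k.+1)%N = false by lia.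
have r_k2 := top k k.+1 (leqnn _) h1'.2; have kr2 : (k.+3 <= r)%N by lia.
constructor 3; split.
  split=> //; try lia.
  (* For k = 0 the only value so far would be t 0 = 2, not 0. *)
  case: (posnP k) => // k0; exfalso; move: tk h1'; rewrite k0 => tk.
  by rewrite no_zero; [case | case=> // _; lia].
have d2 : (\sum_(j < k.+2) t j = \sum_(j < k.+2) j + (t k.+1 + 1 - k))%N.
  by apply: excess_step d1 _; lia.
have h2 := H k.+2 _ (ltnW kr2) d2.
have [t1|t1] : t k.+1 = k \/ t k.+1 = k.+1 by lia.
  have d3 : (\sum_(j < k.+3) t j = \sum_(j < k.+3) j + (t k.+2 - k.+1))%N.
    by apply: excess_step d2 _; lia.
  have h3 := H k.+3 _ kr2 d3.
  have [t2|t2] : t k.+2 = k.+1 \/ t k.+2 = k.+3 by lia.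
    by constructor 1.
  have r_k3 := top k.+2 k.+3 (leqnn _); have kr3 : (k.+4 <= r)%N by lia.
  have d4 : (\sum_(j < k.+4) t j = \sum_(j < k.+4) j + (t k.+3 - k.+1))%N.
    by apply: excess_step d3 _; lia.
  have h4 := H k.+4 _ kr3 d4.
  by constructor 3; split=> //; lia.
have d3 : (\sum_(j < k.+3) t j = \sum_(j < k.+3) j + (t k.+2 - k))%N.
  by apply: excess_step d2 _; lia.
have h3 := H k.+3 _ kr2 d3.
by constructor 2; split=> //; lia.
Qed.

Definition basic_form (r : nat) (b : 'S_r.+1) : Prop :=
  (exists2 k : nat, (1 <= k <= r)%N & b = word_elt r [:: k]) \/
  (exists2 k : nat, (2 <= k <= r - 2)%N & b = word_elt r [:: k.+1; k]) \/
  (exists2 k : nat, (2 <= k <= r - 2)%N & b = word_elt r [:: k; k.+1]) \/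
  (exists2 k : nat, (2 <= k <= r - 2)%N & b = word_elt r [:: k; k.+1; k]) \/
  (exists2 k : nat, (2 <= k <= r - 3)%N & b = word_elt r [:: k.+2; k; k.+1]).

(** If t = b^-1 maps [k, k+n) into itself, then k+n is not crossed, and
    connectedness leaves no crossed index above it; so b is the identity outside
    this interval. *)
Lemma eq_word_on_interval (r k n : nat) (b : 'S_r.+1) (w : seq nat) :
    dynkin_connected (influence b) -> crosses b k.+1 ->
    (forall m, (m <= k)%N -> ~~ crosses b m) -> (0 < n)%N -> is_word r w ->
    (forall j, (j < k)%N || (k + n <= j)%N -> foldr nat_swap j w = j) ->
    all (fun j => (nat_perm b^-1 j < k + n) && (foldr nat_swap (nat_perm b^-1 j) w == j))%N
      (iota k n) ->
  b = word_elt r w.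
Proof.
move=> /connected_influenceP b_conn b_k nc_k n0 wr w_out /allP w_in.
set l := (k + n)%N in w_out w_in; have kl : (k < l)%N by lia.
have {w_in} t_in j : (k <= j < l)%N ->
    (nat_perm b^-1 j < l)%N /\ foldr nat_swap (nat_perm b^-1%g j) w = j.
  by rewrite -mem_iota => /w_in/andP[-> /eqP->].
have below j : (nat_perm b^-1 j < k)%N = (j < k)%N.
  by apply: uncrossed_nat; rewrite crossesV nc_k.
have nc_l : ~~ crosses b l.
  rewrite -crossesV; apply/negP => /crossesP[j].
  by have := below j; have := t_in j; lia.
have nc m : (l <= m)%N -> ~~ crosses b m.
  move=> lm; apply: contra nc_l => b_m; apply: (b_conn k.+1 l m) => //.
  by rewrite kl.
have b_fix j : (j < k)%N || (l <= j)%N -> nat_perm b j = j.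
  by case/orP=> j_out; apply: uncrossed_fix; [apply: nc_k|apply: nc_k|apply: nc|apply: nc]; lia.
apply: eq_nat_perm => j; rewrite nat_perm_word //.
have [j_out|] := boolP ((nat_perm b j < k) || (l <= nat_perm b j))%N.
  have bj : nat_perm b j = j by apply: (can_inj (nat_permK b)); rewrite b_fix.
  by rewrite bj w_out // -bj.
rewrite negb_or -leqNgt -ltnNge => /t_in[_].
by rewrite nat_permK => ->.
Qed.

Lemma connected_allowable_basic_form (r : nat) (b : 'S_r.+1) : b != 1%g ->
    dynkin_connected (influence b) ->
    (forall m, (1 <= m <= r)%N -> allowable_at b m) ->
  basic_form b.
Proof.
move=> b1 b_conn b_ok.
case: (ex_minnP (crosses_neq1 b1)) => [[|k] b_k k_min]; first by have := crosses_range b_k.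
have kr := crosses_range b_k.
have nc_k m : (m <= k)%N -> ~~ crosses b m by move=> mk; apply/negP => /k_min; lia.
have below j : (nat_perm b^-1 j < k)%N = (j < k)%N.
  by apply: uncrossed_nat; rewrite crossesV nc_k.
have t_k : nat_perm b^-1 k <> k.
  move=> tk; case/crossesP: b_k => j; rewrite ltnS leq_eqVlt => /andP[/predU1P[->|jk]].
    by rewrite -{2}tk nat_permKV ltnn.
  by rewrite leqNgt (ltn_trans _ (leqnn _)) // (uncrossed_nat j (nc_k k (leqnn k))).
have eq_word := eq_word_on_interval b_conn b_k nc_k.
have := @excess_shapes r k (nat_perm b) (nat_perm b^-1%g).
case=> //; try by [exact: nat_permK | exact: nat_permKV | exact: nat_perm_le].
- by move=> j kj; rewrite leqNgt below -leqNgt.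
- by apply: excess_uncrossed; [lia | exact: nc_k].
- by move=> m d mr /(allowable_at_excess mr) <-; exact: b_ok.
- case=> t0 t1; left; exists k.+1 => //.
  apply: (eq_word 2) => //; first by rewrite /=; lia.
    by move=> j j_out; swap_lia.
  by rewrite /= t0 t1; swap_lia.
- case=> k1 kr2 t0 t1 t2; right; left; exists k.+1; first by lia.
  apply: (eq_word 3) => //; first by rewrite /=; lia.
    by move=> j j_out; swap_lia.
  by rewrite /= t0 t1 t2; swap_lia.
case=> -[k1 kr2 t0] [[t1 t2]|[t1 t2]|[kr3 t1 t2 t3]]; do 2 right.
- left; exists k.+1; first by lia.
  apply: (eq_word 3) => //; first by rewrite /=; lia.
    by move=> j j_out; swap_lia.
  by rewrite /= t0 t1 t2; swap_lia.
- right; left; exists k.+1; first by lia.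
  apply: (eq_word 3) => //; first by rewrite /=; lia.
    by move=> j j_out; swap_lia.
  by rewrite /= t0 t1 t2; swap_lia.
right; right; exists k.+1; first by lia.
apply: (eq_word 4) => //; first by rewrite /=; lia.
  by move=> j j_out; swap_lia.
by rewrite /= t0 t1 t2 t3; swap_lia.
Qed.

Lemma nat_perm_word_inv (r : nat) (w : seq nat) (j : nat) : is_word r w ->
  nat_perm (word_elt r w)^-1%g j = foldr nat_swap j (rev w).
Proof.
elim: w j => [|k w IH] j /=; first by rewrite invg1 nat_perm1.
case/andP=> kr /IH{}IH.
by rewrite invMg {1}/simple_refl tpermV nat_permM nat_perm_refl // IH rev_cons foldr_rcons.
Qed.

(** A certificate for an explicit word: d is its excess, [k, l] its interval of
    crossed indices, and [g m] a point that crosses m. *)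
Lemma word_connected_allowable (r : nat) (w : seq nat) (k l : nat) (d g : nat -> nat) :
    is_word r w -> (k <= l)%N -> d 0 = 0 ->
    (forall m, d m + foldr nat_swap m (rev w) = d m.+1 + m)%N ->
    (forall m, (1 <= m <= r)%N ->
       (d m + (foldr nat_swap r w < m) <= 1 + (foldr nat_swap 0 w < m))%N) ->
    (forall m j, (j < m <= foldr nat_swap j w)%N -> (k <= m <= l)%N) ->
    (forall m, (k <= m <= l)%N -> (g m < m <= foldr nat_swap (g m) w)%N) ->
  [/\ forall m, (1 <= m <= r)%N -> allowable_at (word_elt r w) m,
      word_elt r w != 1%g & dynkin_connected (influence (word_elt r w))].
Proof.
move=> wr kl d0 d_step d_ok cr_in in_cr.
have crE m : crosses (word_elt r w) m = (k <= m <= l)%N.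
  apply/crossesP/idP => [[j]|/in_cr]; first by rewrite nat_perm_word // => /cr_in.
  by exists (g m); rewrite nat_perm_word.
split.
- move=> m mr; apply/(@allowable_at_excess _ _ m (d m) mr); last by rewrite !nat_perm_word // d_ok.
  elim: m {mr} => [|m IH]; first by rewrite !big_ord0 d0.
  by apply: excess_step IH _; rewrite nat_perm_word_inv.
- have : crosses (word_elt r w) k by rewrite crE leqnn.
  by apply: contraTneq => ->; apply/existsPn => x; rewrite perm1; lia.
- by apply/connected_influenceP => i m j; rewrite !crE; lia.
Qed.

Lemma basic_form_connected_allowable (r : nat) (b : 'S_r.+1) : (2 <= r)%N -> basic_form b ->
  [/\ forall m, (1 <= m <= r)%N -> allowable_at b m, b != 1%g
    & dynkin_connected (influence b)].
Proof.
move=> r2; case=> [|[|[|[|]]]] [k kr ->].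
- apply: (@word_connected_allowable _ _ k k (fun m => (m == k) : nat) (fun=> k.-1))
    => [|||m|m|m j|m]; swap_lia.
- apply: (@word_connected_allowable _ _ k k.+1
    (fun m => (m == k) + (m == k.+1) * 2)%N (fun=> k.-1)) => [|||m|m|m j|m]; swap_lia.
- apply: (@word_connected_allowable _ _ k k.+1
    (fun m => (m == k) * 2 + (m == k.+1))%N predn) => [|||m|m|m j|m]; swap_lia.
- apply: (@word_connected_allowable _ _ k k.+1
    (fun m => (m == k) * 2 + (m == k.+1) * 2)%N (fun=> k.-1)) => [|||m|m|m j|m]; swap_lia.
apply: (@word_connected_allowable _ _ k k.+2
    (fun m => (m == k) * 2 + (m == k.+1) + (m == k.+2) * 2)%N
    (fun m => if m == k then k.-1 else k)) => [|||m|m|m j|m].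
all: try by swap_lia.
by case: eqP => mk; swap_lia.
Qed.

Theorem theorem4p7 (R : realType) (r : nat) (r_ge2 : (2 <= r)%N)
    (S : {set 'S_r.+1}) :
  is_BAS (highest_root R r) (- highest_root R r)%R S <->
  (forall b : 'S_r.+1, b \in S <->
    (exists2 k : nat, (1 <= k <= r)%N & b = word_elt r [:: k]) \/
    (exists2 k : nat, (2 <= k <= r - 2)%N & b = word_elt r [:: k.+1; k]) \/
    (exists2 k : nat, (2 <= k <= r - 2)%N & b = word_elt r [:: k; k.+1]) \/
    (exists2 k : nat, (2 <= k <= r - 2)%N & b = word_elt r [:: k; k.+1; k]) \/
    (exists2 k : nat, (2 <= k <= r - 3)%N & b = word_elt r [:: k.+2; k; k.+1])).
Proof.
have r1 : (1 <= r)%N := ltnW r_ge2.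
rewrite is_BAS_iff => [|s x /(alternation_setP R s r1) s_A]; last first.
  apply/alternation_setP => // m mr.
  by apply: allowable_block; [lia | exact: s_A].
split=> S_E b; rewrite S_E -/(basic_form b); split.
- case=> /(alternation_setP R b r1) b_A b1 b_conn.
  exact: connected_allowable_basic_form.
- by case/(basic_form_connected_allowable r_ge2); split=> //; apply/alternation_setP.
- by case/(basic_form_connected_allowable r_ge2); split=> //; apply/alternation_setP.
- case=> /(alternation_setP R b r1) b_A b1 b_conn.
  exact: connected_allowable_basic_form.
Qed.
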